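(* Let $n\ge 1$ be an integer, let $\xi$ be a nonnegative random variable with all moments $\mathbf{E}[\xi^k]$, $k=1,2,\ldots$, finite and $\mathbf{E}[\xi]>0$, let $\xi_1,\ldots,\xi_n$ be independent copies of $\xi$, and let $Y_n=\xi_1\xi_2\cdots\xi_n$. If $$\frac{\mathbf{E}[\xi^{k+1}]}{\mathbf{E}[\xi^k]}=\mathcal{O}((k+1)^{2/n})\quad\text{as } k\to\infty,$$ then $Y_n$ satisfies Carleman's condition, $\sum_{k=1}^{\infty}\left(\mathbf{E}[Y_n^k]\right)^{-1/(2k)}=\infty$, and $Y_n$ is M-det.
   Context: A nonnegative random variable with all moments finite is called M-det (moment determinate, in the sense of the Stieltjes moment problem) if its distribution is the only probability distribution on $[0,\infty)$ having its moment sequence. *)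

(* Defs.v *)
From HB Require Import structures.
From mathcomp Require Import all_boot all_order all_algebra.
From mathcomp Require Import all_classical all_reals all_analysis.
From mathcomp Require Import measurable_realfun.

Set Implicit Arguments.
Unset Strict Implicit.
Unset Printing Implicit Defensive.

Import Order.TTheory GRing.Theory Num.Theory.
Import numFieldNormedType.Exports.

Local Open Scope classical_set_scope.
Local Open Scope ring_scope.

(* Nonnegativity is almost sure: it is a property of the law, hence it passes
   from a random variable to its copies. *)
Definition nonneg_rv (d : measure_display) (T : measurableType d)
    (R : realType) (P : probability T R) (X : {RV P >-> R}) : Prop :=
  {ae P, forall w, 0 <= X w}.
Arguments nonneg_rv {d T R} P X.

Definition moment (d : measure_display) (T : measurableType d)
    (R : realType) (P : probability T R) (X : {RV P >-> R}) (k : nat) : \bar R :=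
  ('E_P[(fun w => X w ^+ k)%R])%E.
Arguments moment {d T R} P X k.

Definition finite_moments (d : measure_display) (T : measurableType d)
    (R : realType) (P : probability T R) (X : {RV P >-> R}) : Prop :=
  forall k : nat, moment P X k \is a fin_num.
Arguments finite_moments {d T R} P X.

Definition mutually_independent (d : measure_display) (T : measurableType d)
    (R : realType) (P : probability T R) (I : finType)
    (X : I -> {RV P >-> R}) : Prop :=
  forall (J : {set I}) (B : I -> set R),
    (forall i, i \in J -> measurable (B i)) ->
    (P (\bigcap_(i in [set` J]) (X i @^-1` B i)) =
     \prod_(i in J) P (X i @^-1` B i))%E.
Arguments mutually_independent {d T R} P {I} X.

(* The copies may live on another probability space than the original. *)
Definition independent_copies (d0 d : measure_display) (T0 : measurableType d0)
    (T : measurableType d) (R : realType) (P0 : probability T0 R)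
    (P : probability T R) (I : finType) (xi : {RV P0 >-> R})
    (X : I -> {RV P >-> R}) : Prop :=
  mutually_independent P X /\
  forall i (A : set R), measurable A ->
    distribution P (X i) A = distribution P0 xi A.
Arguments independent_copies {d0 d T0 T R} P0 P {I} xi X.

(* [fine] is only meaningful for finite moments, and a vanishing moment would
   contribute 0 instead of +oo; neither happens for a nonnegative random
   variable with finite moments and positive mean. *)
Definition carleman (d : measure_display) (T : measurableType d)
    (R : realType) (P : probability T R) (Y : {RV P >-> R}) : Prop :=
  (\sum_(1 <= k <oo)
     ((fine (moment P Y k) `^ (- (1 / (2 * k%:R))))%R)%:E = +oo)%E.
Arguments carleman {d T R} P Y.

(* Being nonnegative with all moments finite is part of the notion. *)
Definition M_det (d : measure_display) (T : measurableType d)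
    (R : realType) (P : probability T R) (X : {RV P >-> R}) : Prop :=
  [/\ nonneg_rv P X, finite_moments P X &
    forall mu : probability R R,
      mu `[0, +oo[%classic = 1%E ->
      (forall k : nat, (\int[mu]_x (x ^+ k)%:E)%E = moment P X k) ->
      forall A : set R, measurable A -> mu A = distribution P X A].
Arguments M_det {d T R} P X.

(* Main.v *)
Require Import Defs.
From HB Require Import structures.
From mathcomp Require Import all_boot all_order all_algebra.
From mathcomp Require Import all_classical all_reals all_analysis.
From mathcomp Require Import measurable_realfun.
From mathcomp Require Import ring lra zify.

Set Implicit Arguments.
Unset Strict Implicit.
Unset Printing Implicit Defensive.

Import Order.TTheory GRing.Theory Num.Theory.
Import numFieldNormedType.Exports.

Local Open Scope classical_set_scope.
Local Open Scope ring_scope.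

(** Why the theorem is true.  Write m_k = E[xi^k] and M_k = E[Y^k].  By
    independence M_k = m_k^n, so raising the growth condition to the n-th power
    gives M_{k+1} <= B (k+1)^2 M_k for large k.  Everything follows from this
    one inequality.

    Carleman's condition.  By induction M_k <= (D k)^(2k), hence
    M_k^(-1/(2k)) >= 1/(D k), and the harmonic series diverges
    ([carleman_of_growth]).

    Determinacy.  The theorem of Carleman, with the quasi-analyticity behind it,
    can be avoided: the inequality gives M_k = O(B^k (k!)^2) = O(B^k (2k)!),
    which is Hardy's condition, i.e. the square root of Y has an exponential
    moment.  So let mu and nu be two laws on the half line with moments M_k,
    and put y = sqrt x.

    - The moments of mu determine its cosine transform, the integral of
      cos (s y) ([eq_cos_transform]).  For small s this is the power series of
      the cosine integrated term by term; the product formula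
      2 cos(s y) cos(t y) = cos((s+t) y) + cos((s-t) y) then carries the
      equality, for all the weights y^(2k) at once, from s - t and s to s + t.
      This replaces analytic continuation.

    - The cosine transform determines the law of y ([eq_measure_lt]).  The
      functions whose integrals agree contain the algebra generated by the
      cosines, and an explicit sequence [cos_cutoff] in that algebra, with
      values in [0, 1], converges pointwise to the indicator function of
      [0, pi/2).  Bounded convergence gives equal masses to the sets y < a, and
      these generate the Borel sets.  This replaces Fourier inversion.

    The formula M_k = m_k^n is [prod_moment], a case of the product rule
    [expectation_prod_indep]. *)

(** * Expectation of a product of independent variables *)

Section weighted_composition.
Context d (T : measurableType d) (R : realType) (P : probability T R).
Import HBNNSimple.
Local Open Scope ereal_scope.

(** The measures B |-> E[W 1_B(X)] and B |-> c P(X in B) coincide, so they give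
    the same integral to [g]; the passage from sets to [g] is the approximation
    by simple functions and monotone convergence. *)
Lemma integral_weighted_comp (W : T -> R) (X : {RV P >-> R}) (c : R)
    (g : R -> R) :
  measurable_fun setT W -> (forall w, (0 <= W w)%R) ->
  (forall B : set R, measurable B ->
    \int[P]_w (W w * \1_B (X w))%:E = c%:E * P (X @^-1` B)) ->
  measurable_fun setT g -> (forall x, (0 <= g x)%R) ->
  \int[P]_w (W w * g (X w))%:E = c%:E * \int[P]_w (g (X w))%:E.
Proof.
move=> mW W0 WB mg g0.
have mEg : measurable_fun [set: R] (EFin \o g) by exact/measurable_EFinP.
pose h := nnsfun_approx measurableT mEg.
have hg x : (EFin \o h ^~ x) @ \oo --> (g x)%:E.
  by apply: (cvg_nnsfun_approx measurableT mEg) => // y _; rewrite lee_fin.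
have nh x : {homo (h ^~ x) : m n / (m <= n)%N >-> (m <= n)%R}.
  by move=> m n mn; exact/lefP/nd_nnsfun_approx.
have mX : measurable_fun setT X by [].
have mhX n : measurable_fun setT (fun w => h n (X w)).
  by apply: measurableT_comp.
have step n : \int[P]_w (W w * h n (X w))%:E = c%:E * \int[P]_w (h n (X w))%:E.
  have mind r : measurable_fun setT (fun w => \1_(h n @^-1` [set r]) (X w) : R).
    by apply: measurableT_comp => //; exact: measurable_indic.
  have ge0 r w : (0 <= r * \1_(h n @^-1` [set r]) (X w))%R.
    by rewrite -lee_fin EFinM nnfun_muleindic_ge0.
  have fin : finite_set (range (h n)) by exact: fimfunP.
  transitivity (\int[P]_w (\sum_(r \in range (h n))
      (W w * (r * \1_(h n @^-1` [set r]) (X w)))%:E)).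
    apply: eq_integral => w _; rewrite fsumEFin//; congr EFin.
    rewrite [in LHS](fimfunE (h n)) !fsbig_finite//= mulr_sumr.
    by apply: eq_bigr => r _.
  transitivity (c%:E * \int[P]_w (\sum_(r \in range (h n))
      (r * \1_(h n @^-1` [set r]) (X w))%:E)); last first.
    congr (_ * _); apply: eq_integral => w _; rewrite fsumEFin//; congr EFin.
    by rewrite [in RHS](fimfunE (h n)).
  rewrite !ge0_integral_fsum//; last 4 first.
  - by move=> r; apply/measurable_EFinP; exact: measurable_funM.
  - by move=> r w _; rewrite lee_fin.
  - by move=> r; apply/measurable_EFinP; apply: measurable_funM => //; exact: measurable_funM.
  - by move=> r w _; rewrite lee_fin mulr_ge0.
  rewrite ge0_mule_fsumr; last by move=> r; apply: integral_ge0 => w _; rewrite lee_fin.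
  apply: eq_fsbigr => r _.
  have [r0|r0] := ltP r 0%R.
    have e w : \1_(h n @^-1` [set r]) (X w) = 0%R :> R.
      rewrite indicE memNset// => /= hr.
      by move: r0; rewrite -hr ltNge fun_ge0.
    rewrite !integral0_eq ?mule0// => w _; by rewrite e !mulr0.
  under eq_integral do rewrite mulrCA EFinM.
  under [in RHS]eq_integral do rewrite EFinM.
  rewrite ge0_integralZl//; last 2 first.
  - by apply/measurable_EFinP; exact: measurable_funM.
  - by move=> w _; rewrite lee_fin mulr_ge0.
  rewrite ge0_integralZl//; last exact/measurable_EFinP.
  rewrite WB// muleCA; congr (_ * (_ * _)).
  rewrite [RHS](_ : _ = \int[P]_w (\1_(X @^-1` (h n @^-1` [set r])) w)%:E)//.
  by rewrite integral_indic ?setIT// -[_ @^-1` _]setTI; exact: mX.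
have lim1 : \int[P]_w (W w * h n (X w))%:E @[n --> \oo] --> \int[P]_w (W w * g (X w))%:E.
  rewrite (_ : \int[P]_w (W w * g (X w))%:E =
    \int[P]_w limn (fun n => (W w * h n (X w))%:E)).
    apply: cvg_monotone_convergence => //.
    - by move=> n; apply/measurable_EFinP; exact: measurable_funM.
    - by move=> n w _; rewrite lee_fin mulr_ge0.
    - by move=> w _ m n mn; rewrite lee_fin ler_wpM2l// nh.
  apply: eq_integral => w _; apply/esym/cvg_lim => //.
  under eq_fun do rewrite EFinM.
  by rewrite EFinM; apply: cvgeZl => //; exact: hg.
have lim2 : \int[P]_w (h n (X w))%:E @[n --> \oo] --> \int[P]_w (g (X w))%:E.
  rewrite (_ : \int[P]_w (g (X w))%:E = \int[P]_w limn (fun n => (h n (X w))%:E)).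
    apply: cvg_monotone_convergence => //.
    - by move=> n; apply/measurable_EFinP.
    - by move=> n w _; rewrite lee_fin.
    - by move=> w _ m n mn; rewrite lee_fin nh.
  by apply: eq_integral => w _; apply/esym/cvg_lim => //; exact: hg.
have lim3 : \int[P]_w (W w * h n (X w))%:E @[n --> \oo] -->
    c%:E * \int[P]_w (g (X w))%:E.
  by rewrite (funext step); exact: cvgeZl.
exact: (cvg_unique _ lim1 lim3).
Qed.
End weighted_composition.

(** Mutual independence is the product rule for indicator functions.  The
    indicators are exchanged for the [f i] one index at a time: the induction is
    on a list [s] of indices outside which all factors are still indicators, and
    freeing the index [i] is [integral_weighted_comp] with [W] the product of
    the other factors. *)
Lemma expectation_prod_indep d (T : measurableType d) (R : realType)
    (P : probability T R) (I : finType) (X : I -> {RV P >-> R})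
    (f : I -> R -> R) :
  mutually_independent P X ->
  (forall i, measurable_fun setT (f i)) -> (forall i x, 0 <= f i x) ->
  (forall i, (\int[P]_w (f i (X i w))%:E \is a fin_num)%E) ->
  (\int[P]_w (\prod_i f i (X i w))%:E = \prod_i \int[P]_w (f i (X i w))%:E)%E.
Proof.
move=> indep.
suff gen (s : seq I) (g : I -> R -> R) :
    (forall i, measurable_fun setT (g i)) -> (forall i x, 0 <= g i x) ->
    (forall i, (\int[P]_w (g i (X i w))%:E \is a fin_num)%E) ->
    (forall i, i \notin s -> exists2 B, measurable B & g i = \1_B) ->
    (\int[P]_w (\prod_i g i (X i w))%:E = \prod_i \int[P]_w (g i (X i w))%:E)%E.
  by move=> mf f0 ff; apply: (gen (enum I)) => // i; rewrite mem_enum.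
have mX i : measurable_fun setT (X i) by [].
have intind i B : measurable B -> (\int[P]_w (\1_B (X i w))%:E = P (X i @^-1` B))%E.
  move=> mB; rewrite [LHS](_ : _ = \int[P]_w (\1_(X i @^-1` B) w)%:E)%E//.
  by rewrite integral_indic ?setIT// -[_ @^-1` _]setTI; exact: mX.
elim: s g => [|i s ih] g mg g0 fg gind.
  have /choice[B HB] : forall i, exists B, measurable B /\ g i = \1_B.
    by move=> i; have [//|B mB gB] := gind i; exists B.
  have mB i : measurable (B i) by case: (HB i).
  have gB i : g i = \1_(B i) by case: (HB i).
  have := indep [set: I]%SET B (fun i _ => mB i).
  under [X in _ = X -> _]eq_bigl do rewrite finset.in_setT.
  have -> : (\prod_i \int[P]_w (g i (X i w))%:E = \prod_i P (X i @^-1` B i))%E.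
    by apply: eq_bigr => i _; rewrite gB intind.
  move=> <-.
  rewrite (_ : P _ =
      \int[P]_w (\1_(\bigcap_(i in [set` [set: I]%SET]) (X i @^-1` B i)) w)%:E)%E;
    last first.
    rewrite integral_indic ?setIT//.
    apply: fin_bigcap_measurable => // i _.
    by rewrite -[_ @^-1` _]setTI; exact: mX.
  apply: eq_integral => w _; congr EFin.
  rewrite indicE; have [wB|wB] := boolP (w \in _).
    rewrite big1// => i _; rewrite gB indicE mem_set//.
    by move: wB; rewrite inE => /(_ i); apply; rewrite /= finset.in_setT.
  have [i wi] : exists i, ~ B i (X i w).
    apply: contrapT => /forallNP h; move/negP: wB; apply.
    by rewrite inE => i _; apply: contrapT; exact: h.
  by rewrite (bigD1 i)//= gB indicE memNset// mul0r.
have [iss|iNs] := boolP (i \in s).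
  apply: ih => // j js; apply: gind; rewrite inE negb_or js andbT.
  by apply: contra js => /eqP ->.
pose W w := \prod_(j | j != i) g j (X j w).
(* The family [g] with its [i]-th member put back to an indicator. *)
pose gi B := fun j => if j == i then \1_B else g j : R -> R.
have mgX j : measurable_fun setT (fun w => g j (X j w)).
  exact: measurableT_comp.
have c0 j : 0 <= fine (\int[P]_w (g j (X j w))%:E)%E.
  by rewrite fine_ge0//; apply: integral_ge0 => w _; rewrite lee_fin.
pose c := \prod_(j | j != i) fine (\int[P]_w (g j (X j w))%:E)%E.
have cE : (c%:E = \prod_(j | j != i) \int[P]_w (g j (X j w))%:E)%E.
  rewrite /c -prodEFin; apply: eq_bigr => j _; by rewrite fineK.
have WB (B : set R) : measurable B ->
    (\int[P]_w (W w * \1_B (X i w))%:E = c%:E * P (X i @^-1` B))%E.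
  move=> mB.
  have -> : (\int[P]_w (W w * \1_B (X i w))%:E = \int[P]_w (\prod_j gi B j (X j w))%:E)%E.
    apply: eq_integral => w _; congr EFin.
    rewrite [RHS](bigD1 i)//= /gi eqxx mulrC; congr (_ * _).
    by apply: eq_bigr => j /negbTE ->.
  rewrite ih.
  - rewrite (bigD1 i)//= cE muleC; congr (_ * _)%E.
      by apply: eq_bigr => j /negbTE ji; rewrite /gi ji.
    by rewrite /gi eqxx intind.
  - by move=> j; rewrite /gi; case: ifP => // _; exact: measurable_indic.
  - by move=> j x; rewrite /gi; case: ifP.
  - move=> j; rewrite /gi; case: ifP => // _; rewrite intind// fin_num_measure//.
    by rewrite -[_ @^-1` _]setTI; exact: mX.
  - move=> j js; rewrite /gi; case: ifP => [_|ji]; first by exists B.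
    by apply: gind; rewrite inE negb_or ji.
have mW : measurable_fun setT W.
  have -> : W = fun w => \prod_(j <- enum I) (if j != i then g j (X j w) else 1).
    by apply/funext => w; rewrite /W big_mkcond big_enum.
  by apply: measurable_prod => j _; case: (j != i).
have W0 w : 0 <= W w by apply: prodr_ge0 => j _.
rewrite [RHS](bigD1 i)//= -cE muleC -(integral_weighted_comp mW W0 WB (mg i) (g0 i)).
by apply: eq_integral => w _; congr EFin; rewrite (bigD1 i)//= mulrC.
Qed.

(** * Taylor bounds for the cosine *)

Lemma le_normr_derive (R : realType) (f F g G : R -> R) :
  (forall x : R, is_derive x 1 f (F x)) -> (forall x : R, is_derive x 1 g (G x)) ->
  f 0 = 0 -> g 0 = 0 -> (forall x, 0 <= x -> `|F x| <= G x) ->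
  forall x, 0 <= x -> `|f x| <= g x.
Proof.
move=> df dg f0 g0 FG x x0.
have mono (h H : R -> R) : (forall y : R, is_derive y 1 h (H y)) -> h 0 = 0 ->
    (forall y, 0 <= y -> 0 <= H y) -> 0 <= h x.
  move=> dh h0 H0; have ch : {within `[0, x], continuous h}.
    apply: continuous_subspaceT => y.
    by apply/differentiable_continuous/derivable1_diffP.
  have [c c0x] := MVT_segment x0 (fun y _ => dh y) ch.
  rewrite h0 !subr0 => ->; apply: mulr_ge0 => //; apply: H0.
  by move: c0x; rewrite in_itv/= => /andP[].
rewrite ler_norml; apply/andP; split.
- rewrite -subr_ge0 opprK addrC; apply: (mono (g + f) (G + F)) => [|y y0].
  + by rewrite -[LHS]/(g 0 + f 0) f0 g0 addr0.
  + by have := FG _ y0; rewrite ler_norml -[(G + F) y]/(G y + F y) => /andP[]; lra.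
- rewrite -subr_ge0; apply: (mono (g - f) (G - F)) => [|y y0].
  + by rewrite -[LHS]/(g 0 - f 0) f0 g0 subr0.
  + by have := FG _ y0; rewrite ler_norml -[(G - F) y]/(G y - F y) => /andP[]; lra.
Qed.

Definition cos_taylor (R : realType) n (x : R) :=
  \sum_(0 <= j < n) cos_coeff' x j.
Definition sin_taylor (R : realType) n (x : R) :=
  \sum_(0 <= j < n) sin_coeff' x j.

Lemma is_derive_monomial (R : realType) (c : R) n (x : R) :
  is_derive x 1 (fun y : R => c * y ^+ n.+1 / (n.+1)`!%:R) (c * x ^+ n / n`!%:R).
Proof.
have dX : is_derive x 1 (@GRing.exp R ^~ n.+1) (n.+1%:R * x ^+ n).
  by apply: DeriveDef; [exact: exprn_derivable|rewrite exp_derive scaler1].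
rewrite (_ : (fun y => _) = (c / (n.+1)`!%:R) \*: (@GRing.exp R ^~ n.+1)); last first.
  by apply/funext => y /=; rewrite mulrAC.
apply: (is_derive_eq (is_deriveZ _ dX)).
rewrite -[_ *: _]/(_ * _) factS natrM.
have : n.+1%:R != 0 :> R by rewrite pnatr_eq0.
have : n`!%:R != 0 :> R by rewrite pnatr_eq0 -lt0n fact_gt0.
move=> n0 n1.
field.
by rewrite n0 /=; move: n1; rewrite -natr1.
Qed.

Lemma is_derive_sin_taylor (R : realType) n (x : R) :
  is_derive x 1 (sin_taylor n) (cos_taylor n x).
Proof.
elim: n => [|n ih].
  rewrite /cos_taylor big_geq//.
  rewrite [sin_taylor _](_ : _ = cst 0); first exact: is_derive_cst.
  by apply/funext => y; rewrite /sin_taylor big_geq.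
rewrite [sin_taylor _](_ : _ = sin_taylor n + (fun y : R => sin_coeff' y n)); last first.
  by apply/funext => y; rewrite fctE /sin_taylor big_nat_recr.
rewrite /cos_taylor big_nat_recr//=; apply: is_deriveD.
exact: is_derive_monomial.
Qed.

Lemma is_derive_cos_taylor (R : realType) n (x : R) :
  is_derive x 1 (cos_taylor n.+1) (- sin_taylor n x).
Proof.
elim: n => [|n ih].
  rewrite /sin_taylor big_geq// oppr0.
  rewrite [cos_taylor _](_ : _ = cst 1); first exact: is_derive_cst.
  by apply/funext => y; rewrite /cos_taylor big_nat1 /cos_coeff' !expr0 fact0 mulr1 divr1.
rewrite [cos_taylor _](_ : _ = cos_taylor n.+1 + (fun y : R => cos_coeff' y n.+1)); last first.
  by apply/funext => y; rewrite fctE /cos_taylor big_nat_recr.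
rewrite /sin_taylor big_nat_recr//= opprD; apply: is_deriveD.
rewrite /sin_coeff' /cos_coeff' doubleS -!exprnP -2!mulNr -[- (_ ^+ n)]mulN1r -exprS.
exact: is_derive_monomial.
Qed.

(** Each bound is the integral of the previous one: the remainders of the sine
    and the cosine are, up to sign, primitives of one another, and the sequence
    starts from |cos| <= 1. *)
Lemma cos_taylor_bound_ge0 (R : realType) n (x : R) : 0 <= x ->
  `|cos x - cos_taylor n x| <= x ^+ n.*2 / n.*2`!%:R.
Proof.
suff H : (forall x : R, 0 <= x ->
      `|cos x - cos_taylor n x| <= x ^+ n.*2 / n.*2`!%:R) /\
    (forall x : R, 0 <= x ->
      `|sin x - sin_taylor n x| <= x ^+ n.*2.+1 / n.*2.+1`!%:R).
  by move=> x0; apply: H.1.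
have dmon m (y : R) := is_derive_monomial 1 m y.
have {}dmon m (y : R) : is_derive y 1 (fun y => y ^+ m.+1 / (m.+1)`!%:R) (y ^+ m / m`!%:R).
  by have := dmon m y; under eq_fun do rewrite mul1r; rewrite mul1r.
have mon0 m : (0 : R) ^+ m.+1 / (m.+1)`!%:R = 0 by rewrite expr0n/= mul0r.
have sinstep m : (forall x : R, 0 <= x ->
      `|cos x - cos_taylor m x| <= x ^+ m.*2 / m.*2`!%:R) ->
    (forall x : R, 0 <= x ->
      `|sin x - sin_taylor m x| <= x ^+ m.*2.+1 / m.*2.+1`!%:R).
  move=> ih; apply: (le_normr_derive (f := sin - sin_taylor m) _ (dmon _) _ (mon0 _) ih).
    by move=> y; apply: is_deriveB; exact: is_derive_sin_taylor.
  rewrite !fctE sin0 sub0r /sin_taylor big1 ?oppr0// => j _.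
  by rewrite /sin_coeff' expr0n/= mulr0 mul0r.
elim: n => [|n [_ ihs]].
  have c0 (y : R) : 0 <= y -> `|cos y - cos_taylor 0 y| <= y ^+ 0.*2 / 0.*2`!%:R.
    by move=> y0; rewrite /cos_taylor big_geq// subr0 expr0 fact0 divr1 cos_max.
  by split => //; exact: sinstep.
have cn : (forall x : R, 0 <= x ->
      `|cos x - cos_taylor n.+1 x| <= x ^+ n.+1.*2 / n.+1.*2`!%:R).
  rewrite doubleS.
  apply: (le_normr_derive (f := cos - cos_taylor n.+1)
    (F := fun y => - sin y - - sin_taylor n y) _ (dmon _) _ (mon0 _)).
  - by move=> y; apply: is_deriveB; exact: is_derive_cos_taylor.
  - rewrite !fctE cos0 /cos_taylor big_nat_recl// big1 => [|j _].
      by rewrite /cos_coeff' !expr0 fact0 mulr1 divr1 addr0 subrr.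
    by rewrite /cos_coeff' doubleS expr0n/= mulr0 mul0r.
  - by move=> y /ihs; rewrite -opprB normrN; congr (`|_| <= _); rewrite opprK addrC.
by split => //; exact: sinstep.
Qed.

Lemma cos_taylor_bound (R : realType) n (x : R) :
  `|cos x - cos_taylor n x| <= x ^+ n.*2 / n.*2`!%:R.
Proof.
have even m : `|x| ^+ m.*2 = x ^+ m.*2 by rewrite -mul2n !exprM real_normK ?num_real.
have := @cos_taylor_bound_ge0 R n `|x| (normr_ge0 x).
rewrite cos_norm even; congr (`|_ - _| <= _).
by apply: eq_bigr => j _; rewrite /cos_coeff' even.
Qed.

(** * Moments determine the cosine transform *)

Lemma measurable_cos_scale d (T : measurableType d) (R : realType) (y : T -> R)
    (s : R) :
  measurable_fun setT y -> measurable_fun setT (fun x => cos (s * y x)).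
Proof.
move=> my; apply: measurableT_comp; last exact: measurable_funM.
exact: continuous_measurable_fun (@continuous_cos R).
Qed.

Section cosine_transform.
Context d (T : measurableType d) (R : realType).
Variables (mu nu : probability T R) (y : T -> R).
Hypothesis my : measurable_fun setT y.

Let mcos s : measurable_fun setT (fun x => cos (s * y x) : R).
Proof. exact: measurable_cos_scale. Qed.

Section one_measure.
Variable P : probability T R.
Hypothesis moments : forall k, P.-integrable setT (EFin \o (fun x => y x ^+ k.*2)).

Lemma integrable_moment_cos k s :
  P.-integrable setT (EFin \o (fun x => y x ^+ k.*2 * cos (s * y x))).
Proof.
apply: (le_integrable _ _ _ (moments k)) => //.
  by apply/measurable_EFinP/measurable_funM => //; exact: measurable_funX.
move=> x _ /=; rewrite lee_fin normrM ler_piMr// cos_max//.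
Qed.

Lemma integrable_moment_cos2 k s t :
  P.-integrable setT
    (EFin \o (fun x => y x ^+ k.*2 * cos (s * y x) * cos (t * y x))).
Proof.
apply: (le_integrable _ _ _ (integrable_moment_cos k s)) => //.
  apply/measurable_EFinP/measurable_funM => //; apply/measurable_funM => //.
  exact: measurable_funX.
move=> x _ /=; rewrite lee_fin normrM ler_piMr// cos_max//.
Qed.

Lemma Rintegral_moment_cos_add k s t :
  \int[P]_x (y x ^+ k.*2 * cos ((s + t) * y x)) =
  2 * \int[P]_x (y x ^+ k.*2 * cos (s * y x) * cos (t * y x)) -
  \int[P]_x (y x ^+ k.*2 * cos ((s - t) * y x)).
Proof.
rewrite -RintegralZl//; last exact: integrable_moment_cos2.
rewrite -RintegralB//; last 2 first.
- exact: integrableZl (integrable_moment_cos2 k s t).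
- exact: integrable_moment_cos.
apply: eq_Rintegral => x _.
rewrite mulrDl mulrBl cosD cosB; ring.
Qed.

Lemma moment_cos_taylorE k s t n :
  \int[P]_x (y x ^+ k.*2 * cos (s * y x) * cos_taylor n (t * y x)) =
  \sum_(0 <= j < n) (((-1) ^+ j * t ^+ j.*2 / j.*2`!%:R) *
     \int[P]_x (y x ^+ (k + j).*2 * cos (s * y x))) /\
  P.-integrable setT
    (EFin \o (fun x => y x ^+ k.*2 * cos (s * y x) * cos_taylor n (t * y x))).
Proof.
elim: n => [|n [ih iih]].
  rewrite big_geq//; split.
    under eq_Rintegral do rewrite /cos_taylor big_geq// mulr0.
    by rewrite Rintegral_cst// mul0r.
  rewrite (_ : _ \o _ = cst 0%E); first exact: integrable0.
  by apply/funext => x /=; rewrite /cos_taylor big_geq// mulr0.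
rewrite big_nat_recr//= -ih -RintegralZl//; last exact: integrable_moment_cos.
rewrite -RintegralD//; last exact: integrableZl (integrable_moment_cos _ _).
have E x : y x ^+ k.*2 * cos (s * y x) * cos_taylor n.+1 (t * y x) =
   y x ^+ k.*2 * cos (s * y x) * cos_taylor n (t * y x) +
   (-1) ^+ n * t ^+ n.*2 / (n.*2)`!%:R * (y x ^+ (k + n).*2 * cos (s * y x)).
  rewrite /cos_taylor big_nat_recr//= /cos_coeff' -!exprnP exprMn.
  by rewrite doubleD exprD mulrDr; ring.
split; first by apply: eq_Rintegral => x _.
rewrite (_ : _ \o _ =
   (EFin \o (fun x => y x ^+ k.*2 * cos (s * y x) * cos_taylor n (t * y x))) \+
   (fun x => ((-1) ^+ n * t ^+ n.*2 / (n.*2)`!%:R)%:E *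
      (y x ^+ (k + n).*2 * cos (s * y x))%R%:E)%E).
  apply: integrableD => //; apply: integrableZl => //; exact: integrable_moment_cos.
by apply/funext => x; rewrite /= -EFinM -EFinD E.
Qed.

(** The integral against cos (t y) is a limit of finite combinations of the
    integrals of y^(2j) cos (s y); the error is a single term of Hardy's
    series, so no exchange of a series with an integral is needed. *)
Lemma moment_cos_taylor_error k s t n :
  `|\int[P]_x (y x ^+ k.*2 * cos (s * y x) * cos (t * y x)) -
    \sum_(0 <= j < n) (((-1) ^+ j * t ^+ j.*2 / j.*2`!%:R) *
     \int[P]_x (y x ^+ (k + j).*2 * cos (s * y x)))| <=
  t ^+ n.*2 / n.*2`!%:R * \int[P]_x (y x ^+ (k + n).*2).
Proof.
have [<- itaylor] := moment_cos_taylorE k s t n.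
have ic2 := integrable_moment_cos2 k s t.
rewrite -RintegralB//.
have idiff := integrableB measurableT ic2 itaylor.
apply: (le_trans (le_normr_Rintegral _ idiff)) => //.
rewrite -RintegralZl//.
apply: le_Rintegral => //.
- exact: integrable_abse idiff.
- exact: integrableZl (moments _).
move=> x _; rewrite -mulrBr normrM normrM.
have y0 m : 0 <= y x ^+ m.*2 by rewrite exprn_even_ge0 ?odd_double.
rewrite ger0_norm//.
apply: (@le_trans _ _ (y x ^+ k.*2 * 1 * ((t * y x) ^+ n.*2 / (n.*2)`!%:R))).
  apply: ler_pM => //; first exact: mulr_ge0.
    by apply: ler_wpM2l => //; exact: cos_max.
  exact: cos_taylor_bound.
by rewrite mulr1 exprMn doubleD exprD le_eqVlt; apply/orP; left; apply/eqP; ring.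
Qed.

End one_measure.

Variable h : R.
Hypothesis h0 : 0 < h.
Hypothesis mu_moments : forall k,
  mu.-integrable setT (EFin \o (fun x => y x ^+ k.*2)).
Hypothesis nu_moments : forall k,
  nu.-integrable setT (EFin \o (fun x => y x ^+ k.*2)).
Hypothesis eq_moments : forall k,
  \int[mu]_x (y x ^+ k.*2) = \int[nu]_x (y x ^+ k.*2).
Hypothesis hardy : forall k,
  h ^+ n.*2 / n.*2`!%:R * \int[mu]_x (y x ^+ (k + n).*2) @[n --> \oo] --> (0 : R).

Let agree s := forall k,
  \int[mu]_x (y x ^+ k.*2 * cos (s * y x)) =
  \int[nu]_x (y x ^+ k.*2 * cos (s * y x)).

(** Both integrals are within the same Taylor error of the same finite sum, and
    Hardy's condition makes this error tend to 0. *)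
Lemma eq_moment_cos_step s t k : agree s -> 0 <= t <= h ->
  \int[mu]_x (y x ^+ k.*2 * cos (s * y x) * cos (t * y x)) =
  \int[nu]_x (y x ^+ k.*2 * cos (s * y x) * cos (t * y x)).
Proof.
move=> ags /andP[t0 th].
apply/eqP; rewrite -subr_eq0 -normr_le0.
have lim : 2 * (h ^+ n.*2 / n.*2`!%:R * \int[mu]_x (y x ^+ (k + n).*2))
    @[n --> \oo] --> (0 : R).
  by rewrite -[X in _ --> X](mulr0 2); apply: cvgMr; exact: hardy.
rewrite -(cvg_lim _ lim)//; apply: limr_ge; first exact: cvgP lim.
apply: nearW => n.
set A := (X in `|X - _|); set B := (X in `|_ - X|).
have := moment_cos_taylor_error mu_moments k s t n.
have := moment_cos_taylor_error nu_moments k s t n.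
rewrite -/A -/B -eq_moments.
under eq_bigr do rewrite -ags.
set S := \sum_(_ <= _ < _) _; set M := \int[mu]_x _.
have M0 : 0 <= M by apply: Rintegral_ge0 => x _; rewrite exprn_even_ge0 ?odd_double.
have : t ^+ n.*2 / n.*2`!%:R * M <= h ^+ n.*2 / n.*2`!%:R * M.
  by rewrite ler_wpM2r// ler_wpM2r// lerXn2r// nnegrE ?(le_trans t0)//.
rewrite !ler_norml => e /andP[? ?] /andP[? ?]; apply/andP; split; lra.
Qed.

(** The step length [h] does not depend on [k] or [s], so the agreement spreads
    over the whole line.  Only even weights are needed because the product
    formula for cosines involves no sine; the price is an induction that uses
    the two preceding points. *)
Lemma eq_moment_cos s : agree s.
Proof.
suff key t n : 0 <= t <= h -> agree (n%:R * t).
  (* Any [s] is a multiple of a step of length at most [h]. *)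
  pose m := (Num.truncn (`|s| / h)).+1.
  have m0 : 0 < m%:R :> R by rewrite ltr0n.
  have : agree (m%:R * (`|s| / m%:R)).
    apply: key; rewrite divr_ge0//= ler_pdivrMr// mulrC -ler_pdivrMr//.
    by rewrite ltW// truncnS_gt.
  rewrite mulrCA divff ?mulr1; last by rewrite gt_eqF.
  move=> a k; have := a k.
  by have [s0|s0] := leP 0 s; [rewrite ger0_norm|
    rewrite ltr0_norm//; under eq_Rintegral do rewrite mulNr cosN;
    under [in RHS]eq_Rintegral do rewrite mulNr cosN].
move=> th; suff : agree (n%:R * t) /\ agree (n.+1%:R * t) by case.
have a0 : agree 0.
  move=> k; under eq_Rintegral do rewrite mul0r cos0 mulr1.
  by under [in RHS]eq_Rintegral do rewrite mul0r cos0 mulr1.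
elim: n => [|n [ih0 ih1]].
  rewrite mul0r mul1r; split => // k.
  have := eq_moment_cos_step k a0 th.
  under eq_Rintegral do rewrite mul0r cos0 mulr1.
  by under [in X in _ = X -> _]eq_Rintegral do rewrite mul0r cos0 mulr1.
split => // k.
have -> : n.+2%:R * t = n.+1%:R * t + t by rewrite -[n.+2%:R]natr1; ring.
rewrite (Rintegral_moment_cos_add mu_moments) (Rintegral_moment_cos_add nu_moments).
rewrite (eq_moment_cos_step k ih1 th).
have -> : n.+1%:R * t - t = n%:R * t by rewrite -[n.+1%:R]natr1; ring.
by rewrite ih0.
Qed.

Lemma eq_cos_transform s : \int[mu]_x cos (s * y x) = \int[nu]_x cos (s * y x).
Proof.
have := eq_moment_cos s 0.
under eq_Rintegral do rewrite expr0 mul1r.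
by under [in X in _ = X -> _]eq_Rintegral do rewrite expr0 mul1r.
Qed.

End cosine_transform.

(** * A step function as a limit of cosine polynomials *)

Lemma bernoulli_ge (R : realFieldType) (x : R) n :
  0 <= x -> 1 + n%:R * x <= (1 + x) ^+ n.
Proof.
move=> x0; elim: n => [|n ih]; first by rewrite mul0r addr0 expr0.
rewrite exprSr -natr1.
have x1 : 0 <= 1 + x by rewrite addr_ge0.
apply: le_trans (ler_wpM2r x1 ih).
have : 0 <= n%:R * x * x by rewrite !mulr_ge0.
lra.
Qed.

Lemma bernoulli_le (R : realFieldType) (x : R) n :
  0 <= x <= 1 -> 1 - n%:R * x <= (1 - x) ^+ n.
Proof.
move=> /andP[x0 x1]; elim: n => [|n ih]; first by rewrite mul0r subr0 expr0.
rewrite exprSr -natr1.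
have y1 : 0 <= 1 - x by rewrite subr_ge0.
apply: le_trans (ler_wpM2r y1 ih).
have : 0 <= n%:R * x * x by rewrite !mulr_ge0.
lra.
Qed.

Definition haversine (R : realType) (x : R) := (1 - cos x) / 2.

(** With w = haversine (z / 2^j), the factor (1 - w^M)^(N 2^M) tends to 1 when
    w < 1/2 and to 0 when w >= 1/2, that is, when cos (z / 2^j) <= 0.  For
    0 <= z < pi/2 no factor is of the second kind; for z >= pi/2 some halving of z
    lies in [pi/2, pi), so one factor is.  The factor N in the exponent settles
    the boundary case w = 1/2, and the choice M = N^3 makes the N factors
    converge to 1 together. *)
Definition cos_cutoff (R : realType) N (z : R) :=
  \prod_(j < N) (1 - haversine (z / 2 ^+ j) ^+ (N ^ 3)) ^+ (N * 2 ^ (N ^ 3)).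

Lemma haversine01 (R : realType) (x : R) : 0 <= haversine x <= 1.
Proof.
rewrite /haversine; have := cos_geN1 x; have := cos_le1 x.
by move=> ? ?; apply/andP; split; lra.
Qed.

Lemma onemX_itv01 (R : realType) (w : R) m p :
  0 <= w <= 1 -> 0 <= (1 - w ^+ m) ^+ p <= 1.
Proof.
move=> /andP[w0 w1]; have wm0 : 0 <= w ^+ m by rewrite exprn_ge0.
have wm1 : w ^+ m <= 1 by rewrite exprn_ile1.
by rewrite exprn_ge0 ?subr_ge0//= exprn_ile1 ?subr_ge0// gerBl.
Qed.

Lemma cos_cutoff01 (R : realType) N (z : R) : 0 <= cos_cutoff N z <= 1.
Proof.
apply/andP; split.
  apply: prodr_ge0 => j _.
  by case/andP: (onemX_itv01 (N ^ 3) (N * 2 ^ (N ^ 3)) (haversine01 (z / 2 ^+ j))).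
rewrite -[leRHS](@big1_eq R 1 *%R _ (index_enum 'I_N) xpredT).
by apply: ler_prod => j _; exact: onemX_itv01 (haversine01 (z / 2 ^+ j)).
Qed.

(** All factors are at least the one with j = 0, where q = 2 w < 1; Bernoulli's
    inequality reduces the claim to N^2 q^M = O(1/N), true as q^M = O(1/M). *)
Lemma cos_cutoff_ge (R : realType) (z : R) : 0 <= z < pi / 2 ->
  exists2 C : R, 0 <= C & forall N, (0 < N)%N -> 1 - C / N%:R <= cos_cutoff N z.
Proof.
move=> /andP[z0 zpi].
have cz : 0 < cos z.
  rewrite cos_gt0_pihalf// zpi andbT (lt_le_trans _ z0)// oppr_lt0.
  by rewrite divr_gt0// pi_gt0.
have pi0 := pi_gt0 R.
have wle j : haversine (z / 2 ^+ j) <= haversine (z / 2 ^+ 0).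
  have p1 : 1 <= 2 ^+ j :> R by rewrite exprn_ege1// ler1n.
  have zj : z / 2 ^+ j <= z by rewrite ler_pdivrMr ?exprn_gt0// ler_peMr.
  have zj0 : 0 <= z / 2 ^+ j by rewrite divr_ge0// exprn_ge0.
  rewrite /haversine expr0 divr1 ler_pM2r// lerD2l lerN2 leNgt ltr_cos -?leNgt//.
  - by rewrite in_itv/= z0 /=; lra.
  - by rewrite in_itv/= zj0 /=; lra.
pose q := 2 * haversine (z / 2 ^+ 0).
have q1 : q < 1 by rewrite /q /haversine expr0 divr1; lra.
have q0 : 0 <= q by rewrite /q mulr_ge0//; case/andP: (haversine01 (z / 2 ^+ 0)).
have [C C0 qC] : exists2 C : R, 0 <= C & forall m, (0 < m)%N -> q ^+ m <= C / m%:R.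
  move: q0; rewrite le_eqVlt => /predU1P[<-|q0].
    by exists 0 => // m m0; rewrite mul0r expr0n eqn0Ngt m0.
  pose e := q^-1 - 1.
  have e0 : 0 < e by rewrite subr_gt0 invf_gt1.
  exists e^-1; first by rewrite invr_ge0 ltW.
  move=> m m0; rewrite -invfM.
  rewrite -[q ^+ m]invrK lef_pV2 ?posrE ?invr_gt0 ?exprn_gt0//; last first.
    by rewrite mulr_gt0// ltr0n.
  rewrite -exprVn (_ : q^-1 = 1 + e); last by rewrite /e addrC subrK.
  apply: le_trans (bernoulli_ge _ (ltW e0)).
  by rewrite mulrC; lra.
exists C => // N N0.
pose M := (N ^ 3)%N; pose K := (N * 2 ^ M)%N.
have [w0 w1] := andP (haversine01 (z / 2 ^+ 0)).
have wM0 : 0 <= haversine (z / 2 ^+ 0) ^+ M by rewrite exprn_ge0.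
have wM1 : haversine (z / 2 ^+ 0) ^+ M <= 1 by rewrite exprn_ile1.
apply: (@le_trans _ _ ((1 - haversine (z / 2 ^+ 0) ^+ M) ^+ (N * K))); last first.
  rewrite mulnC exprM -[X in _ ^+ X](card_ord N) -prodr_const /cos_cutoff.
  apply: ler_prod => j _; case/andP: (onemX_itv01 M K (haversine01 (z / 2 ^+ 0))) => -> _ /=.
  have [wj0 wj1] := andP (haversine01 (z / 2 ^+ j)).
  have wjM1 : haversine (z / 2 ^+ j) ^+ M <= 1 by rewrite exprn_ile1.
  apply: lerXn2r; rewrite ?nnegrE ?subr_ge0//.
  by rewrite lerD2l lerN2; apply: lerXn2r; rewrite ?nnegrE.
apply: le_trans (bernoulli_le _ _); last by rewrite wM0.
rewrite lerD2l lerN2.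
have -> : (N * K)%:R * haversine (z / 2 ^+ 0) ^+ M = N%:R ^+ 2 * q ^+ M.
  by rewrite /q /K [(2 * _) ^+ M]exprMn !natrM natrX expr2 !mulrA.
have NR : (0 : R) < N%:R by rewrite ltr0n.
have M0 : (0 < M)%N by rewrite expn_gt0 N0.
apply: (le_trans (ler_wpM2l _ (qC M M0))); first by rewrite exprn_ge0// ltW.
rewrite /M natrX le_eqVlt; apply/orP; left; apply/eqP; field.
by rewrite gt_eqF.
Qed.

(** One factor suffices: with u = 2^-M it is at most (1 - u)^(N 2^M), and
    1 - u <= 1 / (1 + u) lets Bernoulli's inequality bound it by 1 / (1 + N). *)
Lemma cos_cutoff_le (R : realType) (z : R) : pi / 2 <= z ->
  exists j : nat, forall N, (j < N)%N -> cos_cutoff N z <= N.+1%:R^-1.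
Proof.
move=> zpi.
have pi0 := pi_gt0 R.
(* The first halving of [z] that is below pi/2 comes from one in [pi/2, pi). *)
have ex : exists j, z / 2 ^+ j < pi / 2.
  exists (Num.truncn z).+1.
  have z0 : 0 <= z by lra.
  rewrite ltr_pdivrMr ?exprn_gt0//.
  have := pihalf_ge1 R => p1.
  have : z < 2 ^+ (Num.truncn z).+1.
    apply: (lt_trans (truncnS_gt z)).
    by rewrite -natrX ltr_nat ltn_expl.
  move=> zlt; apply: (lt_le_trans zlt).
  by rewrite ler_peMl// exprn_ge0.
case: (ex_minnP ex) => -[|j]; first by rewrite expr0 divr1 ltNge zpi.
move=> jlt jmin; exists j => N jN.
have zj : pi / 2 <= z / 2 ^+ j.
  by rewrite leNgt; apply/negP => /jmin; rewrite ltnn.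
have zj' : z / 2 ^+ j < pi.
  move: jlt; rewrite exprSr invfM mulrA => ?; lra.
have w12 : 2^-1 <= haversine (z / 2 ^+ j).
  rewrite /haversine.
  have : cos (z / 2 ^+ j) <= cos (pi / 2).
    by rewrite leNgt ltr_cos -?leNgt// in_itv/=; lra.
  rewrite cos_pihalf; lra.
have [w0 w1] := andP (haversine01 (z / 2 ^+ j)).
pose M := (N ^ 3)%N; pose K := (N * 2 ^ M)%N.
pose u : R := 2^-1 ^+ M.
have u0 : 0 < u by rewrite exprn_gt0.
have u1 : u <= 1 by rewrite exprn_ile1// invf_le1// ler1n.
apply: (@le_trans _ _ ((1 - u) ^+ K)).
  rewrite /cos_cutoff (bigD1 (Ordinal jN))//= -[leRHS]mulr1.
  apply: ler_pM.
  - by case/andP: (onemX_itv01 M K (haversine01 (z / 2 ^+ j))).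
  - by apply: prodr_ge0 => i _; case/andP: (onemX_itv01 M K (haversine01 (z / 2 ^+ i))).
  - have wjM1 : haversine (z / 2 ^+ j) ^+ M <= 1 by rewrite exprn_ile1.
    apply: lerXn2r; rewrite ?nnegrE ?subr_ge0//.
    rewrite lerD2l lerN2; apply: lerXn2r; rewrite ?nnegrE//.
  - rewrite -[leRHS](@big1_eq R 1 *%R _ (index_enum 'I_N) (fun i => i != Ordinal jN)).
    by apply: ler_prod => i _; exact: onemX_itv01 (haversine01 (z / 2 ^+ i)).
have u1' : 0 < 1 + u by rewrite addr_gt0.
apply: (@le_trans _ _ ((1 + u)^-1 ^+ K)).
  apply: lerXn2r; rewrite ?nnegrE ?subr_ge0//; first by rewrite invr_ge0 ltW.
  rewrite -[leRHS]mul1r ler_pdivlMr//.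
  have : 0 <= u * u by rewrite mulr_ge0// ltW.
  lra.
rewrite exprVn lef_pV2 ?posrE ?ltr0n ?exprn_gt0//.
apply: le_trans (bernoulli_ge K (ltW u0)).
rewrite /K natrM natrX /u -mulrA -exprMn divff ?expr1n ?mulr1; last by rewrite pnatr_eq0.
by rewrite -natr1 addrC.
Qed.

Lemma cvg_cos_cutoff (R : realType) (z : R) : 0 <= z ->
  cos_cutoff N z @[N --> \oo] --> ((z < pi / 2)%R%:R : R).
Proof.
move=> z0; have [zlt|zge] := ltP z (pi / 2).
  have [C C0 HC] := cos_cutoff_ge (introT andP (conj z0 zlt)).
  rewrite -cvg_shiftS /=.
  have lim1 : 1 - C / n.+1%:R @[n --> \oo] --> (1 : R).
    rewrite -[X in _ --> X]subr0; apply: cvgB; first exact: cvg_cst.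
    by rewrite -[X in _ --> X](mulr0 C); apply: cvgMr; exact: cvg_harmonic.
  apply: (squeeze_cvgr _ lim1 (cvg_cst (1 : R))).
  apply: nearW => n; rewrite HC//=.
  by case/andP: (cos_cutoff01 n.+1 z).
have [j Hj] := cos_cutoff_le zge.
apply: (squeeze_cvgr _ (cvg_cst (0 : R)) (@cvg_harmonic R)).
exists j.+1 => // N /= jN; rewrite Hj// andbT.
by case/andP: (cos_cutoff01 N z).
Qed.

(** * The cosine transform determines the law *)

Section cosine_determinacy.
Context d (T : measurableType d) (R : realType).
Variables (mu nu : probability T R) (y : T -> R).
Hypothesis my : measurable_fun setT y.
Hypothesis eq_cos : forall s, \int[mu]_x cos (s * y x) = \int[nu]_x cos (s * y x).

Let cosy s x : R := cos (s * y x).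

Let mcos s : measurable_fun setT (cosy s).
Proof. exact: measurable_cos_scale. Qed.

Definition bounded_measurable (f : T -> R) :=
  measurable_fun setT f /\ exists M, forall x, `|f x| <= M.

Lemma bounded_measurable_integrable (P : probability T R) f :
  bounded_measurable f -> P.-integrable setT (EFin \o f).
Proof.
move=> [mf [M fM]].
apply: (le_integrable measurableT _ _ (finite_measure_integrable_cst P M measurableT)).
  exact/measurable_EFinP.
by move=> x _; rewrite /= lee_fin (le_trans (fM x))// ler_norm.
Qed.

Lemma bounded_measurableM f g : bounded_measurable f -> bounded_measurable g ->
  bounded_measurable (fun x => f x * g x).
Proof.
move=> [mf [M fM]] [mg [N gN]]; split; first exact: measurable_funM.
by exists (M * N) => x; rewrite normrM ler_pM.
Qed.

Lemma bounded_measurableB f g : bounded_measurable f -> bounded_measurable g ->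
  bounded_measurable (fun x => f x - g x).
Proof.
move=> [mf [M fM]] [mg [N gN]]; split; first exact: measurable_funB.
by exists (M + N) => x; rewrite (le_trans (ler_normB _ _))// lerD.
Qed.

Lemma bounded_measurable_cst c : bounded_measurable (fun=> c).
Proof. by split; [exact: measurable_cst|exists `|c|]. Qed.

Lemma bounded_measurable_cos s : bounded_measurable (cosy s).
Proof. by split; [exact: mcos|exists 1 => x; exact: cos_max]. Qed.

(** Testing against every cos (s y), and not only integrating, makes this
    condition stable under multiplication by cosines. *)
Definition cos_agree (f : T -> R) := bounded_measurable f /\
  forall s, \int[mu]_x (f x * cosy s x) = \int[nu]_x (f x * cosy s x).

(** The multipliers form an algebra containing the cosines, which is easier to
    see than closure under products of the functions they act on. *)
Definition multiplier (m : T -> R) :=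
  forall f, cos_agree f -> cos_agree (fun x => f x * m x).

Lemma multiplier_ext m m' : m =1 m' -> multiplier m -> multiplier m'.
Proof. by move=> /funext ->. Qed.

Lemma multiplier_cst c : multiplier (fun=> c).
Proof.
move=> f [bf ef]; split; first exact: bounded_measurableM (bounded_measurable_cst c).
move=> s; have E x : f x * c * cosy s x = c * (f x * cosy s x) by ring.
under eq_Rintegral do rewrite E; under [RHS]eq_Rintegral do rewrite E.
have bfc := bounded_measurableM bf (bounded_measurable_cos s).
by rewrite !RintegralZl ?ef//; exact: bounded_measurable_integrable.
Qed.

(** The product formula for cosines turns cos (t y) cos (s y) into half the sum
    of the test functions with parameters s + t and s - t. *)
Lemma multiplier_cos t : multiplier (cosy t).
Proof.
move=> f [bf ef]; split; first exact: bounded_measurableM (bounded_measurable_cos t).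
move=> s; have E x : f x * cosy t x * cosy s x =
    2^-1 * (f x * cosy (s + t) x - (- 1) * (f x * cosy (s - t) x)).
  by rewrite /cosy mulrDl mulrBl cosD cosB; field.
under eq_Rintegral do rewrite E; under [RHS]eq_Rintegral do rewrite E.
have bfc u := bounded_measurableM bf (bounded_measurable_cos u).
have bfc' u := bounded_measurableM (bounded_measurable_cst (- 1)) (bfc u).
have ifc := fun P u => bounded_measurable_integrable P (bfc u).
have ifc' := fun P u => bounded_measurable_integrable P (bfc' u).
have ifd P := bounded_measurable_integrable P
  (bounded_measurableB (bfc (s + t)) (bfc' (s - t))).
rewrite !RintegralZl//; [|exact: ifd..].
rewrite !RintegralB//; [|exact: ifc|exact: ifc'|exact: ifc|exact: ifc'].
by rewrite !RintegralZl//; [rewrite !ef|exact: ifc..].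
Qed.

Lemma multiplierB m m' : multiplier m -> multiplier m' ->
  multiplier (fun x => m x - m' x).
Proof.
move=> mm mm' f af; have [bm em] := mm _ af; have [bm' em'] := mm' _ af.
have E0 x : f x * (m x - m' x) = f x * m x - f x * m' x by ring.
split; first by rewrite (funext E0); exact: bounded_measurableB.
move=> s; have E x : f x * (m x - m' x) * cosy s x =
    f x * m x * cosy s x - f x * m' x * cosy s x by ring.
under eq_Rintegral do rewrite E; under [RHS]eq_Rintegral do rewrite E.
have ib P := bounded_measurable_integrable P
  (bounded_measurableM bm (bounded_measurable_cos s)).
have ib' P := bounded_measurable_integrable P
  (bounded_measurableM bm' (bounded_measurable_cos s)).
by rewrite !RintegralB//; [rewrite em em'|exact: ib|exact: ib'|exact: ib|exact: ib'].
Qed.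

Lemma multiplierM m m' : multiplier m -> multiplier m' ->
  multiplier (fun x => m x * m' x).
Proof.
move=> mm mm' f af; have := mm' _ (mm _ af).
by rewrite (_ : (fun x => f x * m x * m' x) = (fun x => f x * (m x * m' x)))//;
  apply/funext => x; rewrite mulrA.
Qed.

Lemma multiplierX m n : multiplier m -> multiplier (fun x => m x ^+ n).
Proof.
move=> mm; elim: n => [|n ih]; first exact: multiplier_cst.
by apply: multiplier_ext (multiplierM mm ih) => x; rewrite exprS.
Qed.

Lemma multiplier_prod n (m : nat -> T -> R) : (forall j, multiplier (m j)) ->
  multiplier (fun x => \prod_(j < n) m j x).
Proof.
move=> mm; elim: n => [|n ih].
  by apply: multiplier_ext (multiplier_cst 1) => x; rewrite big_ord0.
by apply: multiplier_ext (multiplierM ih (mm n)) => x; rewrite big_ord_recr.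
Qed.

Lemma cos_agree_cutoff N t : cos_agree (fun x => cos_cutoff N (t * y x)).
Proof.
have agree1 : cos_agree (fun=> 1).
  split; first exact: bounded_measurable_cst.
  move=> s; have E : (fun x => 1 * cosy s x) = cosy s.
    by apply/funext => x; rewrite mul1r.
  by rewrite E; exact: eq_cos.
have mcut : multiplier (fun x => cos_cutoff N (t * y x)).
  apply: (multiplier_prod N (m := fun j x =>
    (1 - haversine (t * y x / 2 ^+ j) ^+ (N ^ 3)) ^+ (N * 2 ^ (N ^ 3)))) => j.
  apply: multiplierX; apply: multiplierB; first exact: multiplier_cst.
  apply: multiplierX.
  apply: multiplierM; last exact: multiplier_cst.
  apply: multiplierB; first exact: multiplier_cst.
  by apply: multiplier_ext (multiplier_cos (t / 2 ^+ j)) => x; rewrite /cosy mulrAC.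
have := mcut _ agree1; congr cos_agree.
by apply/funext => x; rewrite mul1r.
Qed.

Lemma Rintegral_cutoff N t :
  \int[mu]_x cos_cutoff N (t * y x) = \int[nu]_x cos_cutoff N (t * y x).
Proof.
have [_ /(_ 0) e] := cos_agree_cutoff N t.
have E : (fun x => cos_cutoff N (t * y x) * cosy 0 x) =
    (fun x => cos_cutoff N (t * y x)).
  by apply/funext => x; rewrite /cosy mul0r cos0 mulr1.
by move: e; rewrite E.
Qed.

Hypothesis y0 : forall x, 0 <= y x.

(** The scale pi/2/a moves the jump of the limiting step function to [a]. *)
Lemma cvg_Rintegral_cutoff (P : probability T R) (a : R) : 0 < a ->
  (\int[P]_x (cos_cutoff N (pi / 2 / a * y x))%:E)%E @[N --> \oo] -->
  P (y @^-1` `]-oo, a[).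
Proof.
move=> a0; have pi0 := pi_gt0 R.
have mA : measurable (y @^-1` `]-oo, a[).
  by rewrite -[_ @^-1` _]setTI; exact: my.
have -> : P (y @^-1` `]-oo, a[) = (\int[P]_x (\1_(y @^-1` `]-oo, a[) x)%:E)%E.
  by rewrite integral_indic// setIT.
have icut N := bounded_measurable_integrable P (cos_agree_cutoff N (pi / 2 / a)).1.
have i1 : P.-integrable setT (EFin \o cst (1 : R)) by exact: finite_measure_integrable_cst.
have [|||_ _ //] := @dominated_convergence _ _ _ P _ measurableT
  (fun N x => (cos_cutoff N (pi / 2 / a * y x))%:E)
  (fun x => (\1_(y @^-1` `]-oo, a[) x)%:E) (EFin \o cst 1)
  (fun N => measurable_int _ (icut N)) _ _ i1 _.
- by apply/measurable_EFinP; exact: measurable_indic.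
- apply: aeW => x _ /=; apply: cvg_EFin; first exact: nearW.
  rewrite [X in _ --> X](_ : _ = ((pi / 2 / a * y x < pi / 2)%R%:R : R)).
    by apply: cvg_cos_cutoff; rewrite mulr_ge0// ltW// !divr_gt0.
  rewrite indicE; congr ((nat_of_bool _)%:R); apply/idP/idP.
    rewrite inE/= in_itv/= => ya; rewrite -mulrA gtr_pMr ?divr_gt0//.
    by rewrite mulrC ltr_pdivrMr// mul1r.
  rewrite inE/= in_itv/= -mulrA gtr_pMr ?divr_gt0//.
  by rewrite mulrC ltr_pdivrMr// mul1r.
- apply: aeW => x N _ /=; rewrite lee_fin.
  have /andP[c0 c1] := cos_cutoff01 N (pi / 2 / a * y x).
  by rewrite ger0_norm.
Qed.

Lemma eq_measure_lt (a : R) :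
  0 < a -> mu (y @^-1` `]-oo, a[) = nu (y @^-1` `]-oo, a[).
Proof.
move=> a0; have cmu := cvg_Rintegral_cutoff (P := mu) a0.
have cnu := cvg_Rintegral_cutoff (P := nu) a0.
apply: (cvg_unique _ cmu) => //.
rewrite (_ : (fun N => _) = (fun N =>
   \int[nu]_x (cos_cutoff N (pi / 2 / a * y x))%:E)%E)//.
apply/funext => N.
have ic P := bounded_measurable_integrable P (cos_agree_cutoff N (pi / 2 / a)).1.
rewrite -[LHS]fineK; last exact: integrable_fin_num (ic mu).
rewrite -[RHS]fineK; last exact: integrable_fin_num (ic nu).
congr EFin; exact: Rintegral_cutoff.
Qed.

End cosine_determinacy.

(** * Consequences of the growth condition *)

Lemma half_ratio_cvg0 (R : realType) (u : R^nat) N :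
  (forall n, 0 <= u n) -> (forall n, (N <= n)%N -> u n.+1 <= u n / 2) ->
  u n @[n --> \oo] --> (0 : R).
Proof.
move=> u0 uS; rewrite -(cvg_shiftn N).
have geo n : u (n + N)%N <= u N * 2^-1 ^+ n.
  elim: n => [|n ih]; first by rewrite expr0 mulr1.
  rewrite addSn (le_trans (uS _ (leq_addl _ _)))// exprSr mulrA.
  by rewrite ler_pM2r.
apply: (squeeze_cvgr _ (cvg_cst (0 : R))).
  by apply: nearW => n /=; rewrite u0 /=; exact: geo.
apply: cvg_geometric; rewrite ger0_norm//; lra.
Qed.

(** The sequence satisfies the ratio test: for n >= k one has
    (k+n+1)^2 <= (2n+1)(2n+2), so the ratio is at most h^2 B.  The admissible
    [h] does not depend on [k]. *)
Lemma hardy_of_growth (R : realType) (M : R^nat) (B h : R) (k0 k : nat) :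
  (forall k, 0 <= M k) -> h ^+ 2 * B <= 2^-1 -> 0 <= B ->
  (forall k, (k0 <= k)%N -> M k.+1 <= B * k.+1%:R ^+ 2 * M k) ->
  h ^+ n.*2 / n.*2`!%:R * M (k + n)%N @[n --> \oo] --> (0 : R).
Proof.
move=> M0 hB B0 MS.
have e0 n : 0 <= h ^+ n.*2 / n.*2`!%:R.
  by rewrite divr_ge0// exprn_even_ge0// odd_double.
apply: (half_ratio_cvg0 (N := maxn k k0)) => [n|n]; first exact: mulr_ge0.
rewrite geq_max => /andP[kn k0n].
rewrite addnS; apply: (le_trans (ler_wpM2l (e0 _) (MS _ (leq_trans k0n (leq_addl _ _))))).
have f0 : 0 < (n.*2)`!%:R :> R by rewrite ltr0n fact_gt0.
have fE : (n.+1.*2)`!%:R = (n.*2.+2%:R * n.*2.+1%:R) * (n.*2)`!%:R :> R.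
  by rewrite doubleS !factS !natrM mulrA.
set p : R := n.*2.+2%:R * n.*2.+1%:R in fE *.
have p0 : 0 < p by rewrite mulr_gt0.
have kb : (k + n).+1%:R ^+ 2 <= p.
  rewrite expr2; apply: ler_pM => //; rewrite ler_nat -addnn; lia.
rewrite fE; set b : R := (k + n).+1%:R in kb *; set f : R := (n.*2)`!%:R in f0 *.
have -> : h ^+ n.+1.*2 / (p * f) * (B * b ^+ 2 * M (k + n)%N) =
    h ^+ n.*2 / f * M (k + n)%N * (h ^+ 2 * B * (b ^+ 2 / p)).
  rewrite doubleS 2!exprS; field.
  by rewrite !gt_eqF.
apply: ler_wpM2l; first exact: mulr_ge0.
rewrite -[leRHS]mulr1; apply: ler_pM => //.
- by rewrite mulr_ge0// sqr_ge0.
- by rewrite divr_ge0// ?sqr_ge0// ltW.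
- by rewrite ler_pdivrMr// mul1r.
Qed.

(** M_k <= (D k)^(2k) by induction, the constant D absorbing the finitely many
    indices where the growth condition is not available. *)
Lemma carleman_of_growth (R : realType) (M : R^nat) (B : R) (k0 : nat) :
  (forall k, 0 < M k) ->
  (forall k, (k0 <= k)%N -> M k.+1 <= B * k.+1%:R ^+ 2 * M k) ->
  (\sum_(1 <= k <oo) (M k `^ (- (1 / (2 * k%:R))))%:E = +oo)%E.
Proof.
move=> M0 MS.
have [A A1 MA] : exists2 A : R, 1 <= A & forall k, (k <= k0.+1)%N -> M k <= A.
  exists (1 + \sum_(j < k0.+2) M j).
    by rewrite lerDl; apply: sumr_ge0 => j _; exact: ltW.
  move=> k kk0; rewrite (bigD1 (Ordinal (n:=k0.+2) (m:=k) kk0))//=.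
  have : 0 <= \sum_(i < k0.+2 | i != Ordinal (n:=k0.+2) (m:=k) kk0) M i.
    by apply: sumr_ge0 => j _; exact: ltW.
  lra.
pose D := A + `|B|.
have DA : A <= D by rewrite lerDl.
have D1 : 1 <= D by exact: le_trans DA.
have D0 : 0 < D by exact: lt_le_trans D1.
have DB : B <= D ^+ 2.
  rewrite (le_trans (ler_norm B))// (@le_trans _ _ D)//.
    by rewrite lerDr (le_trans _ A1).
  by rewrite expr2 ler_peMl// ltW.
have MD k : (0 < k)%N -> M k <= (D * k%:R) ^+ k.*2.
  elim: k => // k ih _; have [kk0|kk0] := leqP k.+1 k0.+1.
    apply: (le_trans (MA _ kk0)); apply: (le_trans DA).
    apply: (@le_trans _ _ (D * k.+1%:R)); first by rewrite ler_peMr ?ler1n// ltW.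
    have Dk : 1 <= D * k.+1%:R by rewrite -[leLHS]mulr1 ler_pM// ler1n.
    by rewrite -[leLHS]expr1; apply: ler_weXn2l.
  apply: (le_trans (MS _ _)); first exact: ltnW.
  have kgt0 : (0 < k)%N by move: kk0; rewrite ltnS; exact: leq_ltn_trans.
  have Mk0 := ltW (M0 k).
  apply: (@le_trans _ _ (D ^+ 2 * k.+1%:R ^+ 2 * M k)).
    by rewrite ler_wpM2r// ler_wpM2r// sqr_ge0.
  have -> : (D * k.+1%:R) ^+ k.+1.*2 =
      D ^+ 2 * k.+1%:R ^+ 2 * (D * k.+1%:R) ^+ k.*2.
    by rewrite doubleS 2!exprS mulrA -exprMn.
  apply: ler_wpM2l; first by rewrite mulr_ge0// sqr_ge0.
  apply: (le_trans (ih kgt0)); apply: lerXn2r; rewrite ?nnegrE ?mulr_ge0 ?(ltW D0)//.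
  by rewrite ler_wpM2l ?ler_nat// ltW.
have term k : (0 < k)%N -> (D * k%:R)^-1 <= M k `^ (- (1 / (2 * k%:R))).
  move=> k0'; have Dk0 : 0 < D * k%:R by rewrite mulr_gt0// ltr0n.
  have kn0 : k%:R != 0 :> R by rewrite pnatr_eq0 -lt0n.
  rewrite powRN lef_pV2 ?posrE ?powR_gt0//.
  have -> : D * k%:R = ((D * k%:R) ^+ k.*2) `^ (1 / (2 * k%:R)).
    rewrite -powR_mulrn ?ltW// -powRrM -mul2n natrM.
    rewrite mulrA mulr1 divff ?powRr1 ?ltW// mulf_neq0//.
  apply: ge0_ler_powR; rewrite ?nnegrE ?exprn_ge0 ?(ltW (M0 k)) ?(ltW Dk0)//.
  exact: MD.
have H : (\sum_(i <oo) ((D * (i + 1)%:R)^-1)%:E = +oo)%E.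
  have H : series (@harmonic R) @ \oo --> +oo.
    apply: nondecreasing_dvgn_lt; last exact: dvg_harmonic.
    apply/nondecreasing_seqP => m; rewrite !seriesEnat/= big_nat_recr//= lerDl.
    by rewrite invr_ge0.
  apply/cvg_lim => //.
  rewrite (_ : (fun n => _) = (fun n => (D^-1 * series (@harmonic R) n)%:E)).
    apply/cvgeryP/cvgryPge => a; move/cvgryPge : H => /(_ (D * a)).
    by apply: filterS => m; rewrite ler_pdivlMl.
  apply/funext => m; rewrite sumEFin; congr EFin.
  rewrite seriesEnat/= mulr_sumr; apply: eq_bigr => i _.
  by rewrite invfM addn1.
apply/eqP; rewrite eq_le leey/= -nneseries_addn; last first.
  by move=> i; rewrite lee_fin powR_ge0.
rewrite -H; apply: lee_nneseries => i _.
  by rewrite lee_fin invr_ge0 mulr_ge0// ltW.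
by rewrite lee_fin term// addn1.
Qed.

(** * Determinacy on the half line *)

Lemma ae_nonneg_line (R : realType) (mu : probability R R) :
  mu `[0, +oo[%classic = 1%E -> {ae mu, forall x, 0 <= x}.
Proof.
move=> mu1; exists (~` `[0, +oo[%classic); split.
- exact: measurableC.
- by rewrite probability_setC// mu1 subee.
- by apply: subsetC => x /=; rewrite in_itv/= andbT.
Qed.

Lemma sqrt_even_moment (R : realType) (mu : probability R R) k :
  mu `[0, +oo[%classic = 1%E ->
  (\int[mu]_x (Num.sqrt x ^+ k.*2)%:E = \int[mu]_x (x ^+ k)%:E)%E.
Proof.
move=> mu1; apply: ae_eq_integral => //.
- apply/measurable_EFinP/measurable_funX.
  exact: continuous_measurable_fun (@sqrt_continuous R).
- exact/measurable_EFinP/measurable_funX.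
apply: filterS (ae_nonneg_line mu1) => x x0 _ /=.
by rewrite -mul2n exprM sqr_sqrtr.
Qed.

(** Hardy's criterion.  The square root turns moments into even moments, of
    which there are just enough for the power series of the cosine. *)
Lemma stieltjes_hardy_unique (R : realType) 
    (mu nu : probability R R) (M : R^nat) (B : R) (k0 : nat) :
  mu `[0, +oo[%classic = 1%E -> nu `[0, +oo[%classic = 1%E ->
  (forall k, (\int[mu]_x (x ^+ k)%:E)%E = (M k)%:E) ->
  (forall k, (\int[nu]_x (x ^+ k)%:E)%E = (M k)%:E) ->
  (forall k, (k0 <= k)%N -> M k.+1 <= B * k.+1%:R ^+ 2 * M k) ->
  forall A, measurable A -> mu A = nu A.
Proof.
move=> mu1 nu1 muM nuM MS.
pose y x : R := Num.sqrt x.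
have my : measurable_fun setT y by exact: continuous_measurable_fun (@sqrt_continuous R).
have mom (P : probability R R) : P `[0, +oo[%classic = 1%E ->
    (forall k, (\int[P]_x (x ^+ k)%:E)%E = (M k)%:E) ->
    (forall k, P.-integrable setT (EFin \o (fun x => y x ^+ k.*2))) /\
    (forall k, \int[P]_x (y x ^+ k.*2) = M k).
  move=> P1 PM; split=> k; last by rewrite /Rintegral sqrt_even_moment// PM.
  apply/integrableP; split; first exact/measurable_EFinP/measurable_funX.
  rewrite (eq_integral (fun x => (y x ^+ k.*2)%:E)); last first.
    by move=> x _; rewrite /= ger0_norm// exprn_ge0// sqrtr_ge0.
  by rewrite sqrt_even_moment// PM ltry.
have [imu Imu] := mom _ mu1 muM; have [inu Inu] := mom _ nu1 nuM.
have M0 k : 0 <= M k.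
  by rewrite -Imu; apply: Rintegral_ge0 => x _; rewrite exprn_ge0// sqrtr_ge0.
(* Any positive [h] with h^2 B' <= 1/2 would do. *)
pose B' := 1 + `|B|.
have B1 : 1 <= B' by rewrite lerDl.
have BB : B <= B' by rewrite (le_trans (ler_norm B))// lerDr.
pose h := (2 * B')^-1.
have h0 : 0 < h by rewrite invr_gt0 mulr_gt0// (lt_le_trans _ B1).
have hB : h * (2 * B') = 1 by rewrite mulVf// gt_eqF// mulr_gt0// (lt_le_trans _ B1).
have h12 : h <= 2^-1 by nra.
have eqcos s : \int[mu]_x cos (s * y x) = \int[nu]_x cos (s * y x).
  apply: (eq_cos_transform my h0 imu inu) => k; first by rewrite Imu Inu.
  under eq_fun do rewrite Imu.
  apply: (hardy_of_growth k M0 (B := B') (k0 := k0)).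
  - by rewrite expr2 -mulrA; nra.
  - by rewrite (le_trans _ B1).
  - move=> j kj; apply: (le_trans (MS j kj)).
    by rewrite ler_wpM2r// ler_wpM2r// sqr_ge0.
have eqlt (a : R) : mu `]-oo, a[%classic = nu `]-oo, a[%classic.
  have neg (P : probability R R) : P `[0, +oo[%classic = 1%E -> a <= 0 ->
      P `]-oo, a[%classic = 0%E.
    move=> P1 a0; apply/eqP; rewrite eq_le measure_ge0 andbT.
    have <- : P (~` `[0, +oo[%classic) = 0%E by rewrite probability_setC// P1 subee.
    apply: le_measure; rewrite ?inE//; first exact: measurableC.
    move=> x /=; rewrite !in_itv/= andbT => xa.
    by apply/negP; rewrite -ltNge (lt_le_trans xa).
  have [a0|a0] := leP a 0; first by rewrite !neg.
  have -> : `]-oo, a[%classic = y @^-1` `]-oo, (y a)[%classic.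
    apply/seteqP; split => x; rewrite /= !in_itv/= /y ltr_sqrt//.
  by apply: eq_measure_lt => //; [move=> x; exact: sqrtr_ge0|rewrite sqrtr_gt0].
move=> A mA.
apply: (measure_unique (@RGenInftyO.G R) (fun n => `]-oo, n%:R[%classic)) => //.
- exact: RGenInftyO.measurableE.
- move=> _ _ [a ->] [b ->]; exists (Num.min a b).
  by apply/seteqP; split=> x /=; rewrite !in_itv/= lt_min => /andP.
- by move=> i; exists i%:R.
- apply/seteqP; split => // x _; exists (Num.truncn x).+1 => //=.
  by rewrite in_itv/= truncnS_gt.
- by move=> _ [a ->]; exact: eqlt.
- by move=> k; rewrite (le_lt_trans (probability_le1 _ _))// ltry.
Qed.

(** * Moments of nonnegative variables and of their products *)

Section nonneg_rv_theory.
Context d (T : measurableType d) (R : realType) (P : probability T R).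
Implicit Types X : {RV P >-> R}.

(** Almost sure nonnegativity is a property of the law, hence shared by copies. *)
Lemma nonneg_rvP X :
  nonneg_rv P X <-> distribution P X `[0, +oo[%classic = 1%E.
Proof.
have mX : measurable (X @^-1` `[0, +oo[%classic).
  by rewrite -[_ @^-1` _]setTI; exact: measurable_funP.
have nE : ~` [set w | 0 <= X w] = ~` (X @^-1` `[0, +oo[%classic).
  by congr (~` _); apply/seteqP; split => w /=; rewrite in_itv/= andbT.
split => [X0|X1].
  have : P (~` (X @^-1` `[0, +oo[%classic)) = 0%E.
    by apply/negligibleP; [exact: measurableC|rewrite -nE].
  move=> PC0; rewrite -[LHS]/(P (X @^-1` `[0, +oo[%classic)).
  by rewrite -[X @^-1` _]setCK probability_setC ?PC0 ?sube0//; exact: measurableC.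
exists (~` (X @^-1` `[0, +oo[%classic)); split.
- exact: measurableC.
- by rewrite probability_setC// [X in (1 - X)%E]X1 subee.
- by rewrite -nE.
Qed.

Lemma measurable_rv_normX X k : measurable_fun setT (fun w => (`|X w| ^+ k)%:E).
Proof.
apply/measurable_EFinP; apply: measurable_funX; exact: measurableT_comp.
Qed.

(** Absolute values make the integrand nonnegative everywhere, so that the
    formulas for integrals of nonnegative functions apply. *)
Lemma nonneg_momentE X k : nonneg_rv P X ->
  moment P X k = (\int[P]_w (`|X w| ^+ k)%:E)%E.
Proof.
move=> X0; rewrite /moment unlock; apply: ae_eq_integral => //.
- by apply/measurable_EFinP; exact: measurable_funX.
- exact: measurable_rv_normX.
by apply: filterS X0 => w w0 _; rewrite ger0_norm.
Qed.

Lemma nonneg_moment_ge0 X k : nonneg_rv P X -> (0 <= moment P X k)%E.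
Proof.
move=> X0; rewrite nonneg_momentE//.
by apply: integral_ge0 => w _; rewrite lee_fin exprn_ge0.
Qed.

Lemma nonneg_moment_distribution X k : nonneg_rv P X ->
  moment P X k = (\int[distribution P X]_x (`|x| ^+ k)%:E)%E.
Proof.
move=> X0; rewrite nonneg_momentE// ge0_integral_distribution//.
by apply/measurable_EFinP; exact: measurable_funX.
Qed.

Lemma moment_gt0 X k : nonneg_rv P X -> (0 < 'E_P[X])%E -> (0 < moment P X k)%E.
Proof.
move=> X0; apply: contraTT; rewrite -!leNgt => mk0.
have {}mk0 : moment P X k = 0%E.
  by apply/eqP; rewrite eq_le mk0 nonneg_moment_ge0.
have : ae_eq P setT (fun w => (`|X w| ^+ k)%:E) (cst 0%E).
  apply/ae_eq_integral_abs => //; first exact: measurable_rv_normX.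
  rewrite -[RHS]mk0 nonneg_momentE//; apply: eq_integral => w _.
  by rewrite gee0_abs// lee_fin exprn_ge0.
move=> ae0; rewrite unlock (ae_eq_integral (cst 0%E))//.
- by rewrite integral0.
- exact/measurable_EFinP.
apply: filterS ae0 => w /(_ I) /= [Xk0] _.
by move/eqP: Xk0; rewrite expf_eq0 normr_eq0 => /andP[_ /eqP ->].
Qed.

End nonneg_rv_theory.

Section independent_product.
Context d0 d (T0 : measurableType d0) (T : measurableType d) (R : realType).
Variables (P0 : probability T0 R) (P : probability T R) (I : finType).
Variables (xi : {RV P0 >-> R}) (X : I -> {RV P >-> R}).
Hypothesis xi_ge0 : nonneg_rv P0 xi.
Hypothesis X_copies : independent_copies P0 P xi X.

Lemma copy_nonneg i : nonneg_rv P (X i).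
Proof. by apply/nonneg_rvP; rewrite X_copies.2//; exact/nonneg_rvP. Qed.

Lemma copy_moment i k : moment P (X i) k = moment P0 xi k.
Proof.
rewrite !nonneg_moment_distribution//; last exact: copy_nonneg.
by apply: eq_measure_integral => A mA _; exact: X_copies.2.
Qed.

Let Y : {RV P >-> R} := \prod_i X i.

Let YE w : Y w = \prod_i X i w.
Proof. by rewrite /Y; elim/big_rec2: _ => //= i a Z _ <-. Qed.

Lemma prod_nonneg : nonneg_rv P Y.
Proof.
have : {ae P, forall w, forall i, 0 <= X i w}.
  by apply: filter_forall => i; exact: copy_nonneg.
by apply: filterS => w Xw; rewrite YE; apply: prodr_ge0.
Qed.

Lemma prod_moment k : finite_moments P0 xi ->
  (moment P Y k = \prod_(i : I) moment P0 xi k)%E.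
Proof.
move=> xi_mom; rewrite nonneg_momentE; last exact: prod_nonneg.
have E w : `|Y w| ^+ k = \prod_i (`|X i w| ^+ k).
  by rewrite YE normr_prod prodrXl.
under eq_integral do rewrite E.
have mi i : (\int[P]_w (`|X i w| ^+ k)%:E = moment P0 xi k)%E.
  by rewrite -nonneg_momentE; [exact: copy_moment|exact: copy_nonneg].
rewrite (expectation_prod_indep (f := fun _ x => `|x| ^+ k) X_copies.1).
- by apply: eq_bigr => i _.
- by move=> i; apply: measurable_funX.
- by move=> i x; rewrite exprn_ge0.
- by move=> i; rewrite mi.
Qed.

End independent_product.

Lemma M_det_of_growth d (T : measurableType d) (R : realType) (P : probability T R)
    (Y : {RV P >-> R}) (B : R) (k0 : nat) :
  nonneg_rv P Y -> finite_moments P Y ->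
  (forall k, (k0 <= k)%N -> fine (moment P Y k.+1) <=
     B * k.+1%:R ^+ 2 * fine (moment P Y k)) ->
  M_det P Y.
Proof.
move=> Y0 Yfin growth; split => // mu mu1 muY.
have Y1 := (nonneg_rvP Y).1 Y0.
apply: (stieltjes_hardy_unique mu1 Y1 (M := fun k => fine (moment P Y k)) _ _ growth) => k.
  by rewrite muY fineK.
rewrite fineK// nonneg_moment_distribution//; apply: ae_eq_integral => //.
- by apply/measurable_EFinP; apply: measurable_funX.
- by apply/measurable_EFinP; apply: measurable_funX.
by apply: filterS (ae_nonneg_line Y1) => x x0 _; rewrite ger0_norm.
Qed.

Theorem theorem2 (R : realType) (n : nat) (hn : (1 <= n)%N)
  (d0 : measure_display) (T0 : measurableType d0) (P0 : probability T0 R)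
  (xi : {RV P0 >-> R})
  (xi_ge0 : nonneg_rv P0 xi)
  (xi_mom : finite_moments P0 xi)
  (xi_mean : (0 < 'E_P0[xi])%E)
  (d : measure_display) (T : measurableType d) (P : probability T R)
  (X : 'I_n -> {RV P >-> R})
  (X_copies : independent_copies P0 P xi X)
  (growth :
    (fun k : nat => fine (moment P0 xi k.+1) / fine (moment P0 xi k))
      =O_\oo (fun k : nat => (k.+1%:R : R) `^ (2 / n%:R))) :
  let Y : {RV P >-> R} := \prod_(i < n) X i in
  carleman P Y /\ M_det P Y.
Proof.
move=> Y.
have m_gt0 k : 0 < fine (moment P0 xi k).
  by rewrite fine_gt0// moment_gt0//= ltey_eq xi_mom.
have YE k : moment P Y k = (fine (moment P0 xi k) ^+ n)%:E.
  rewrite (prod_moment xi_ge0 X_copies)// -[in LHS](fineK (xi_mom k)) prodEFin prodr_const.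
  by rewrite card_ord.
have [B B0 [k0 _ mB]] := (eqO_exP _ _ _).1 growth.
have MS k : (k0 <= k)%N -> fine (moment P Y k.+1) <=
    B ^+ n * k.+1%:R ^+ 2 * fine (moment P Y k).
  move=> k0k; rewrite !YE/=; have := mB k k0k.
  rewrite ger0_norm; last by rewrite divr_ge0// ltW.
  rewrite ger0_norm ?powR_ge0// ler_pdivrMr// => mk.
  (* This is where the exponent 2/n becomes 2. *)
  have -> : k.+1%:R ^+ 2 = (k.+1%:R `^ (2 / n%:R)) ^+ n :> R.
    rewrite -[RHS]powR_mulrn ?powR_ge0// -powRrM divfK ?pnatr_eq0 -?lt0n//.
    by rewrite powR_mulrn.
  rewrite -!exprMn; apply: lerXn2r => //; rewrite nnegrE ?ltW//.
  by rewrite !mulr_gt0// powR_gt0.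
have Yfin : finite_moments P Y by move=> k; rewrite YE.
split.
  by apply: (carleman_of_growth _ MS) => k; rewrite YE/= exprn_gt0.
by apply: (M_det_of_growth _ Yfin MS); exact: (prod_nonneg xi_ge0 X_copies).
Qed.
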